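(* For any positive integer $n$, a nonempty set of vertices $A$ of the $n$-cycle $C_n$ has minimal energy if and only if it is maximally even.
   Context: All graphs are finite and simple. The $n$-cycle $C_n$ has vertex set $\{0,1,\ldots,n-1\}$, with $i$ adjacent to $i+1$ modulo $n$ (for $n=1$ this is a single vertex, and for $n=2$ a single edge). The distance between two vertices $u\neq v$ of a connected graph is the number of edges in a shortest path from $u$ to $v$. Maximally even: a set of vertices in $C_n$ with cardinality $m$ (where $1\le m\le n$) is maximally even if it is of the form $$J^r_{n,m}=\left\{\left\lfloor\frac{ni+r}{m}\right\rfloor : i=0,1,\ldots,m-1\right\}$$ for some integer $r$ with $0\le r\le n-1$. Energy: let $G$ be a finite simple connected graph and $A$ a set of vertices of $G$ with $|A|=m$. The distance vector of $A$ is the tuple $\vec{D}(A)=(d_1,\ldots,d_\ell)$ of all distances between (unordered) pairs of distinct elements of $A$, listed with multiplicity and with $d_1\le\cdots\le d_\ell$, where $\ell=\binom{m}{2}$. The energy of $A$ is $E(A)=\frac{1}{d_1}+\cdots+\frac{1}{d_\ell}$ (an empty sum is $0$). The set $A$ has minimal energy if $E(A)\le E(B)$ for every set $B$ of vertices of $G$ with $|B|=|A|$. *)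

(* Defs.v *)
From mathcomp Require Import all_boot all_order all_algebra.

Set Implicit Arguments.
Unset Strict Implicit.
Unset Printing Implicit Defensive.

Import Order.TTheory GRing.Theory Num.Theory.

Record connected_graph := ConnectedGraph {
  vertex :> finType;
  adj : rel vertex;
  adj_sym : symmetric adj;
  adj_irr : irreflexive adj;
  adj_connected : forall u v, connect adj u v
}.

Section Energy.
Variable G : connected_graph.
Implicit Types (u v : G) (A B : {set G}).

(* The tuple [p] omits the starting vertex [u], so its length is the number of
   edges of the path. *)
Definition has_path u v (k : nat) : bool :=
  [exists p : k.-tuple G,
     [&& path (@adj G) u p, uniq (u :: p) & last u p == v]].

Fact has_path_ex u v : exists k, has_path u v k.
Proof.
have /connectP [p e_p ->] := adj_connected u v.
case/shortenP: e_p => p' e_p' uniq_p' _.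
by exists (size p'); apply/existsP; exists (in_tuple p'); rewrite e_p' uniq_p' /=.
Qed.

Definition dist u v : nat := ex_minn (has_path_ex u v).

(* Each unordered pair is listed once, through the arbitrary total order given
   by [enum_rank]; as [dist] is symmetric, that order is irrelevant. *)
Definition dist_vector A : seq nat :=
  sort leq [seq dist p.1 p.2 | p : G * G in
    [pred p : G * G | [&& p.1 \in A, p.2 \in A
                        & enum_rank p.1 < enum_rank p.2]]].

Definition energy A : rat := (\sum_(d <- dist_vector A) (d%:R)^-1)%R.

Definition minimal_energy A : Prop :=
  forall B, #|B| = #|A| -> (energy A <= energy B)%R.

End Energy.

(* The condition [i != j] only matters for [n = 1], where it removes the
   loop. *)
Definition cycle_adj (n : nat) : rel 'I_n :=
  fun i j => (i != j) &&
    ((j == i.+1 %% n :> nat) || (i == j.+1 %% n :> nat)).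

Fact cycle_adj_sym n : symmetric (@cycle_adj n).
Proof. by move=> i j; rewrite /cycle_adj eq_sym orbC. Qed.

Fact cycle_adj_irr n : irreflexive (@cycle_adj n).
Proof. by move=> i; rewrite /cycle_adj eqxx. Qed.

Fact cycle_adj_connected n (i j : 'I_n) : connect (@cycle_adj n) i j.
Proof.
case: n i j => [[] //|n] i j.
suff from0 (k : 'I_n.+1) : connect (@cycle_adj n.+1) ord0 k.
  by apply: connect_trans (from0 j); rewrite sym_connect_sym //; exact: cycle_adj_sym.
case: k => k; elim: k => [|k IHk] lt_k.
  by rewrite (_ : Ordinal _ = ord0) ?connect0 //; apply: val_inj.
apply: connect_trans (IHk (ltnW lt_k)) (connect1 _).
by rewrite /cycle_adj -val_eqE /= modn_small // eqxx neq_ltn ltnSn.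
Qed.

Definition cycle_graph (n : nat) : connected_graph :=
  ConnectedGraph (@cycle_adj_sym n) (@cycle_adj_irr n) (@cycle_adj_connected n).

(* For [0 < m] and [r < n] all the values [(n * i + r) %/ m] are below [n], so
   reading them inside ['I_n] loses none of them. *)
Definition J (n m r : nat) : {set 'I_n} :=
  [set j : 'I_n | [exists i : 'I_m, j == (n * i + r) %/ m :> nat]].

Definition maximally_even (n : nat) (A : {set 'I_n}) : Prop :=
  0 < #|A| /\ exists2 r : nat, r < n & A = J n #|A| r.

(* Main.v *)
Require Import Defs.
From mathcomp Require Import all_boot all_order all_algebra.
From mathcomp Require Import zify ring lra.

(** List the elements of [A] as [a 0 < ... < a (m - 1)] in [0, n).  The distance
    between [a i] and [a j] is the shorter of the two arcs [s = a j - a i] and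
    [n - s], so the energy is the sum of [f (a j - a i)] over [i < j], where
    [f s = max (1 / s, 1 / (n - s))].  This [f] is strictly convex and invariant
    under [s |-> n - s].

    Fix [k = j - i].  If the set were spread uniformly, [a j - a i] would be
    [n k / m].  Bound [f] from below by an affine function that touches it only
    at the integers at distance less than 1 from [n k / m] ([two_chords_leif]).
    Since [f] is symmetric, the slopes [c k] of these affine functions satisfy
    [c (m - k) = - c k], and for such slopes the sum over [i < j] of
    [c (j - i) * (a j - a i)] vanishes whatever [a] is ([sum_antisym_gaps]).
    So the affine bounds add up to a number that depends only on [n] and [m],
    and the energy reaches it exactly when every [a j - a i] is at distance less
    than 1 from [n (j - i) / m] ([sum_gaps_leif]).

    This condition says that the numbers [b i = m * a i - n * i] differ from
    each other by less than [m].  If [r] is the largest of them, it amounts to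
    [b i <= r < b i + m], that is, [a i = (n * i + r) %/ m]; hence it
    characterizes the maximally even sets ([maximally_evenP]).  As such sets
    exist for all [m <= n], the lower bound is the minimal energy, and its
    equality case is the theorem. *)

Set Implicit Arguments.
Unset Strict Implicit.
Unset Printing Implicit Defensive.

Import Order.TTheory GRing.Theory Num.Theory.

Local Open Scope ring_scope.

(** * Supporting chords of a strictly convex sequence *)

Section Chords.
Variable R : realFieldType.
Implicit Types (f c a : nat -> R) (m n q s k : nat).

Definition strictly_convex n f : Prop :=
  forall s, (0 < s < n)%N -> f s *+ 2 < f s.-1 + f s.+1.

Definition chord f q s : R := f q + (f q.+1 - f q) * (s%:R - q%:R).

Lemma slope_mono n f p q : strictly_convex n f -> (p < q < n)%N ->
  f p.+1 - f p < f q.+1 - f q.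
Proof.
move=> cvx_f /andP[lt_pq]; elim: q lt_pq => // q IHq lt_pq lt_qn.
have step := cvx_f q.+1; rewrite lt_qn /= mulr2n in step.
have {}step := step isT.
move: lt_pq; rewrite ltnS leq_eqVlt => /predU1P[->|lt_pq]; first lra.
have := IHq lt_pq (ltnW lt_qn); lra.
Qed.

Lemma chord_leif n f q s : strictly_convex n f -> (q < n)%N -> (s <= n)%N ->
  chord f q s <= f s ?= iff ((s == q) || (s == q.+1)).
Proof.
move=> cvx_f lt_qn le_sn.
have right t : (q.+1 < t <= n)%N -> chord f q t < f t.
  elim: t => // t IHt /andP[lt_qt lt_tn].
  have := @slope_mono n f q t cvx_f ltac:(lia).
  move: lt_qt; rewrite ltnS leq_eqVlt => /predU1P[<-|lt_qt].
    by rewrite /chord -!natr1; lra.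
  have := IHt ltac:(lia).
  by rewrite /chord -(natr1 t); lra.
have left t : (t < q)%N -> chord f q (q - t.+1) < f (q - t.+1)%N.
  elim: t => [|t IHt] lt_tq.
    have [p def_q] : {p | q = p.+1} by exists q.-1; lia.
    have := @slope_mono n f p q cvx_f ltac:(lia).
    by rewrite /chord def_q subn1 /= -!natr1; lra.
  have := @slope_mono n f (q - t.+2)%N q cvx_f ltac:(lia).
  have := IHt ltac:(lia).
  have -> : (q - t.+1)%N = (q - t.+2).+1 by lia.
  by rewrite /chord -!natr1; lra.
case: (ltngtP s q) => [lt_sq | gt_sq | ->] /=.
- rewrite (_ : (s == q.+1) = false); last lia.
  apply/leifP; have := left (q - s.+1)%N ltac:(lia).
  by rewrite (_ : q - (q - s.+1).+1 = s)%N //; lia.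
- apply/leifP; case: eqP => [->|ne_sq].
    by rewrite /chord -natr1; apply/eqP; ring.
  by apply: right; lia.
- by apply/leifP; rewrite /chord subrr mulr0 addr0.
Qed.

(** The floor of the average gap [n k / m], and its ceiling minus 1.  They
    differ only if [n k / m] is an integer: [f] is then supported at that
    integer by one chord on each side of it. *)
Definition floor_gap n m k : nat := ((n * k) %/ m)%N.
Definition ceil_gap_pred n m k : nat := ((n * k).-1 %/ m)%N.

Lemma floor_gap_lt n m k : (0 < n)%N -> (k < m)%N -> (floor_gap n m k < n)%N.
Proof.
by move=> n_gt0 lt_km; rewrite /floor_gap ltn_divLR ?ltn_pmul2l //; lia.
Qed.

Lemma ceil_gap_pred_lt n m k :
  (0 < n)%N -> (k < m)%N -> (ceil_gap_pred n m k < n)%N.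
Proof.
move=> n_gt0 lt_km; apply: leq_ltn_trans (floor_gap_lt n_gt0 lt_km).
by rewrite leq_div2r ?leq_pred.
Qed.

(** The endpoints common to the two chords are the integers [s] such that
    [|s - n k / m| < 1]. *)
Lemma common_endpointsE n m k s : (0 < n)%N -> (0 < k < m)%N ->
  ((s == floor_gap n m k) || (s == (floor_gap n m k).+1)) &&
  ((s == ceil_gap_pred n m k) || (s == (ceil_gap_pred n m k).+1))
  = (n * k < m * s + m)%N && (m * s < n * k + m)%N.
Proof.
move=> n_gt0 /andP[k_gt0 lt_km]; rewrite /floor_gap /ceil_gap_pred.
have nk_gt0 : (0 < n * k)%N by rewrite muln_gt0 n_gt0.
have m_gt0 : (0 < m)%N by lia.
have := divn_eq (n * k) m; have := ltn_pmod (n * k) m_gt0.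
have := divn_eq (n * k).-1 m; have := ltn_pmod (n * k).-1 m_gt0.
move: ((n * k) %% m)%N ((n * k) %/ m)%N ((n * k).-1 %% m)%N ((n * k).-1 %/ m)%N.
move=> r1 q1 r2 q2; move: (n * k)%N nk_gt0 => N N_gt0 lt1 e1 lt2 e2.
apply/idP/idP; nia.
Qed.

(** The reflection [s |-> n - s] exchanges the average gaps [n k / m] and
    [n (m - k) / m], and the two chords with them. *)
Lemma gaps_rev n m k : (0 < n)%N -> (0 < k < m)%N ->
  floor_gap n m (m - k) = (n.-1 - ceil_gap_pred n m k)%N /\
  ceil_gap_pred n m (m - k) = (n.-1 - floor_gap n m k)%N.
Proof.
move=> n_gt0 /andP[k_gt0 lt_km].
have := ceil_gap_pred_lt n_gt0 lt_km; have := floor_gap_lt n_gt0 lt_km.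
rewrite /floor_gap /ceil_gap_pred mulnBr.
have m_gt0 : (0 < m)%N by lia.
have nk_gt0 : (0 < n * k)%N by rewrite muln_gt0 n_gt0.
have := divn_eq (n * k) m; have := ltn_pmod (n * k) m_gt0.
have := divn_eq (n * k).-1 m; have := ltn_pmod (n * k).-1 m_gt0.
move: ((n * k) %% m)%N ((n * k) %/ m)%N ((n * k).-1 %% m)%N ((n * k).-1 %/ m)%N.
move=> r1 q1 r2 q2; move: (n * k)%N nk_gt0 => N N_gt0 lt1 e1 lt2 e2 lt_q1 lt_q2.
split.
  have -> : (n * m - N = (n.-1 - q2) * m + (m.-1 - r2))%N.
    have : (n.-1 - q2 + q2.+1 = n)%N by lia.
    by move: (n.-1 - q2)%N => d <-; nia.
  by rewrite divnMDl // divn_small ?addn0 //; lia.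
have -> : ((n * m - N).-1 = (n.-1 - q1) * m + (m.-1 - r1))%N.
  have : (n.-1 - q1 + q1.+1 = n)%N by lia.
  by move: (n.-1 - q1)%N => d <-; nia.
by rewrite divnMDl // divn_small ?addn0 //; lia.
Qed.

Definition two_chords n m f k s : R :=
  chord f (floor_gap n m k) s + chord f (ceil_gap_pred n m k) s.

Lemma two_chords_leif n m f k s :
    strictly_convex n f -> (0 < n)%N -> (0 < k < m)%N -> (s <= n)%N ->
  two_chords n m f k s <= f s *+ 2
    ?= iff (n * k < m * s + m)%N && (m * s < n * k + m)%N.
Proof.
move=> cvx_f n_gt0 k_bnd le_sn; have /andP[_ lt_km] := k_bnd.
rewrite -common_endpointsE // mulr2n.
by apply: leifD; apply: (@chord_leif n) => //;
  [apply: floor_gap_lt | apply: ceil_gap_pred_lt].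
Qed.

(** * The lower bound on a sum over gaps *)

(** The coefficient of [a j] is the sum of the [c k] for [0 < k <= j], coming
    from the indices below [j], minus the sum of the [c k] for [0 < k < m - j],
    coming from the indices above.  By antisymmetry the latter is the opposite
    of the sum of the [c k] for [j < k < m], so the coefficient is the sum of
    all the [c k], which is its own opposite. *)
Lemma sum_antisym_gaps c m a :
    (forall k, (0 < k < m)%N -> c (m - k)%N = - c k) ->
  \sum_(j < m) \sum_(i < j) c (j - i)%N * (a j - a i) = 0.
Proof.
move=> c_anti.
have csum0 : \sum_(1 <= k < m) c k = 0.
  suff : \sum_(1 <= k < m) c k = - \sum_(1 <= k < m) c k by move=> h; lra.
  rewrite {1}big_nat_rev -sumrN /=; apply: eq_big_nat => k lt_k.
  by rewrite add1n subSS c_anti.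
have below (j : 'I_m) :
    \sum_(i < m | (i < j)%N) c (j - i)%N = \sum_(1 <= k < j.+1) c k.
  rewrite -(big_ord_widen _ (fun i => c (j - i)%N)); last exact: ltnW.
  rewrite -(big_mkord xpredT (fun i => c (j - i)%N)) big_add1 big_nat_rev /=.
  by apply: eq_big_nat => i lt_i; congr c; lia.
have above (j : 'I_m) :
    \sum_(i < m | (j < i)%N) c (i - j)%N = - \sum_(j.+1 <= k < m) c k.
  rewrite -sumrN big_nat_rev /=.
  rewrite [RHS](eq_big_nat _ _ (F2 := fun i => c (i - j)%N)); last first.
    by move=> i lt_i; rewrite -c_anti; [congr c|]; lia.
  by rewrite big_geq_mkord.
have widen (j : 'I_m) (F : nat -> R) :
    \sum_(i < j) F i = \sum_(i < m | (i < j)%N) F i.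
  by rewrite -big_ord_widen // ltnW.
transitivity (\sum_(j < m) (\sum_(i < m | (i < j)%N) c (j - i)%N
    - \sum_(i < m | (j < i)%N) c (i - j)%N) * a j).
  under [RHS]eq_bigr => j _ do rewrite mulrBl !mulr_suml.
  rewrite sumrB [X in _ - X](exchange_big_dep xpredT) //= -sumrB.
  apply: eq_bigr => j _; rewrite (widen j (fun i => c (j - i)%N * (a j - a i))).
  by rewrite -sumrB; apply: eq_bigr => i _; rewrite mulrBr.
apply: big1 => j _; rewrite below above opprK -big_cat_nat //=.
by rewrite csum0 mul0r.
Qed.

(** The affine bounds are evaluated at 0 because their linear parts cancel in
    the sum over all pairs. *)
Definition sum_bound n m f : R :=
  \sum_(j < m) \sum_(i < j) two_chords n m f (j - i) 0.

(** The two inequalities say that [|a j - a i - n (j - i) / m| < 1]. *)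
Definition evenly_spaced n m (a : nat -> nat) : bool :=
  [forall j : 'I_m, [forall i : 'I_j,
     (n * (j - i) < m * (a j - a i) + m)%N &&
     (m * (a j - a i) < n * (j - i) + m)%N]].

Lemma sum_gaps_leif n m f (a : nat -> nat) :
    strictly_convex n f -> (forall s, (s <= n)%N -> f (n - s)%N = f s) ->
    (0 < n)%N -> (forall i j, (i < j < m)%N -> (a i < a j < n)%N) ->
  sum_bound n m f <= (\sum_(j < m) \sum_(i < j) f (a j - a i)%N) *+ 2
    ?= iff evenly_spaced n m a.
Proof.
move=> cvx_f sym_f n_gt0 inc_a.
pose d q := f q.+1 - f q.
pose c k := d (floor_gap n m k) + d (ceil_gap_pred n m k).
have d_rev q : (q < n)%N -> d (n.-1 - q)%N = - d q.
  move=> lt_qn; rewrite /d -(sym_f q) 1?ltnW // -(sym_f q.+1) // opprB.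
  by congr (f _ - f _); lia.
have c_anti k : (0 < k < m)%N -> c (m - k)%N = - c k.
  move=> k_bnd; have /andP[_ lt_km] := k_bnd.
  have [l h] := gaps_rev n_gt0 k_bnd.
  by rewrite /c l h !d_rev ?floor_gap_lt ?ceil_gap_pred_lt //; lra.
have -> : sum_bound n m f =
    \sum_(j < m) \sum_(i < j) two_chords n m f (j - i) (a j - a i).
  rewrite -[LHS]addr0.
  rewrite -[X in _ + X](sum_antisym_gaps (fun i => (a i)%:R) c_anti).
  rewrite /sum_bound -big_split /=.
  apply: eq_bigr => j _; rewrite -big_split; apply: eq_bigr => i _ /=.
  have /andP[lt_a _] := inc_a i j ltac:(by rewrite !ltn_ord).
  by rewrite /two_chords /chord natrB 1?ltnW // /c /d; ring.
rewrite -sumrMnl; apply: leif_sum => j _.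
rewrite -sumrMnl; apply: leif_sum => i _.
have lt_ij := ltn_ord i; have lt_jm := ltn_ord j.
have /andP[lt_a lt_an] := inc_a i j ltac:(by rewrite !ltn_ord).
by apply: two_chords_leif => //; lia.
Qed.

End Chords.

(** * The reciprocal of the arc length *)

Definition arc_dist n s : nat := minn s (n - s).

(** The values at [0] and [n] are no distances.  Setting them to 2 makes the
    sequence strictly convex on the whole of [0, n], so that all the chords can
    be used, those next to the ends included. *)
Definition recip_arc n s : rat :=
  if (0 < s < n)%N then (arc_dist n s)%:R^-1 else 2.

Lemma recip_arc_sym n s : (s <= n)%N -> recip_arc n (n - s) = recip_arc n s.
Proof.
move=> le_sn; rewrite /recip_arc /arc_dist subKn // minnC.
by rewrite (_ : (0 < n - s < n)%N = (0 < s < n)%N) //; lia.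
Qed.

Lemma recip_arc_ge n s : (0 < s)%N -> s%:R^-1 <= recip_arc n s.
Proof.
move=> s_gt0; rewrite /recip_arc s_gt0 /=; case: ltnP => [lt_sn | _].
  rewrite lef_pV2 ?posrE ?ltr0n ?ler_nat /arc_dist ?geq_minl //.
  by rewrite leq_min s_gt0 subn_gt0.
by apply: (@le_trans _ _ 1) => //; rewrite invf_le1 ?ltr0n // ler1n.
Qed.

(** By symmetry [s] may be taken in the first half, where [recip_arc n s] is
    [1 / s]; as [recip_arc n t >= 1 / t] everywhere, the claim follows from the
    strict convexity of [1 / s]. *)
Lemma recip_arc_convex n : strictly_convex n (recip_arc n).
Proof.
have half s : (0 < s < n)%N -> (s <= n - s)%N ->
    recip_arc n s *+ 2 < recip_arc n s.-1 + recip_arc n s.+1.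
  move=> /andP[s_gt0 lt_sn] le_s.
  have -> : recip_arc n s = s%:R^-1.
    by rewrite /recip_arc s_gt0 lt_sn /arc_dist (minn_idPl le_s).
  have ge_up := @recip_arc_ge n s.+1 isT.
  case: s => [//|[|s]] in s_gt0 lt_sn le_s ge_up *.
    have : 0 < 2^-1 :> rat by [].
    have -> : recip_arc n 0 = 2 by [].
    by move: ge_up; rewrite /= invr1; lra.
  have ge_dn := @recip_arc_ge n s.+1 isT.
  apply: lt_le_trans (lerD ge_dn ge_up).
  have x_gt0 : 0 < s.+1%:R :> rat by rewrite ltr0n.
  rewrite -(natr1 s.+2) -(natr1 s.+1); move: (s.+1%:R : rat) x_gt0 => x x_gt0.
  rewrite -subr_gt0.
  have -> : x^-1 + (x + 1 + 1)^-1 - (x + 1)^-1 *+ 2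
      = 2 / (x * (x + 1) * (x + 2)).
    by field; apply/and3P; split; apply: lt0r_neq0; lra.
  by rewrite divr_gt0 // !mulr_gt0 //; lra.
move=> s lt_s; case: (leqP s (n - s)) => [|gt_s]; first exact: half.
have := half (n - s)%N ltac:(lia) ltac:(lia).
rewrite recip_arc_sym; last lia.
rewrite (_ : (n - s).-1 = n - s.+1)%N; last lia.
rewrite (_ : (n - s).+1 = n - s.-1)%N; last lia.
by rewrite !recip_arc_sym 1?addrC //; lia.
Qed.

Local Close Scope ring_scope.

(** * Distances in the cycle *)

Lemma dist_le_path (G : connected_graph) (u : G) p :
  path (@adj G) u p -> dist u (last u p) <= size p.
Proof.
move=> e_p; rewrite /dist; case: ex_minnP => k _ min_k.
case/shortenP: e_p min_k => p' e_p' uniq_p' sub_p' min_k.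
apply: leq_trans (min_k (size p') _) _; last first.
  by case/andP: uniq_p' => _ uniq_p'; apply: uniq_leq_size.
by apply/existsP; exists (in_tuple p'); rewrite e_p' uniq_p' /=.
Qed.

Lemma dist_refl (G : connected_graph) (u : G) : dist u u = 0.
Proof. by apply/eqP; rewrite -leqn0; apply: (@dist_le_path G u [::]). Qed.

Lemma dist_adj (G : connected_graph) (u v w : G) :
  adj v w -> dist u w <= (dist u v).+1.
Proof.
move=> adj_vw; rewrite {2}/dist; case: ex_minnP => k /existsP[p].
case/and3P=> e_p _ /eqP last_p _.
have := @dist_le_path G u (rcons p w).
by rewrite rcons_path last_rcons size_rcons size_tuple last_p e_p; apply.
Qed.

(** Lower bounds on a distance come from functions that grow by at most 1 along
    each edge. *)
Lemma lipschitz_le_dist (G : connected_graph) (h : G -> nat) u v :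
    (forall x y, adj x y -> h y <= (h x).+1) -> h u = 0 ->
  h v <= dist u v.
Proof.
move=> lip_h hu0; rewrite /dist; case: ex_minnP => k /existsP[p].
case/and3P=> e_p _ /eqP<- _.
suff: h (last u p) <= h u + size p by rewrite hu0 size_tuple.
elim: (tval p) u e_p {hu0} => /= [|x q IHq] u; first by rewrite addn0.
case/andP=> /lip_h le_h /IHq; lia.
Qed.

Lemma cycle_adj_succ n (i j : 'I_n) : 1 < n -> j = i.+1 %% n :> nat ->
  cycle_adj i j && cycle_adj j i.
Proof.
move=> n_gt1 def_j.
rewrite andbC cycle_adj_sym andbb /cycle_adj def_j eqxx andbT.
rewrite -val_eqE /= def_j; have := ltn_ord i.
rewrite leq_eqVlt => /predU1P[def_n|lt_n]; last by rewrite modn_small //; lia.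
by rewrite def_n modnn; lia.
Qed.

Lemma dist_cycle_le n (u v : cycle_graph n) t : 1 < n ->
    (v : 'I_n) = ((u : 'I_n) + t) %% n :> nat
    \/ (u : 'I_n) = ((v : 'I_n) + t) %% n :> nat ->
  dist u v <= t.
Proof.
move=> n_gt1; have n_gt0 := ltnW n_gt1.
elim: t v => [|t IHt] v; rewrite ?addn0.
  rewrite !modn_small ?(ltn_ord (_ : 'I_n)) // => uv.
  suff -> : v = u by rewrite dist_refl.
  by apply/val_inj; case: uv.
case=> def_v.
  pose w : 'I_n := Ordinal (ltn_pmod ((u : 'I_n) + t) n_gt0).
  apply: leq_trans (@dist_adj _ u w v _) _; last by rewrite ltnS IHt //; left.
  have succ_w : (v : 'I_n) = w.+1 %% n :> nat.
    by rewrite def_v /= -[in RHS]addn1 modnDml -addnA addn1.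
  by case/andP: (cycle_adj_succ n_gt1 succ_w).
pose w : 'I_n := Ordinal (ltn_pmod (v : 'I_n).+1 n_gt0).
apply: leq_trans (@dist_adj _ u w v _) _.
  by case/andP: (@cycle_adj_succ n v w n_gt1 erefl).
by rewrite ltnS IHt //; right; rewrite def_v /= modnDml addSnnS.
Qed.

Lemma dist_cycle n (u v : cycle_graph n) : (u : 'I_n) < (v : 'I_n) ->
  dist u v = arc_dist n ((v : 'I_n) - (u : 'I_n)).
Proof.
move=> lt_uv; have lt_vn := ltn_ord (v : 'I_n); have n_gt1 : 1 < n by lia.
apply/eqP; rewrite eqn_leq leq_min !dist_cycle_le //=.
- (* With truncated subtraction, the sum below is [|w - u|]. *)
  have /= := @lipschitz_le_dist (cycle_graph n)
    (fun w => arc_dist n (((w : 'I_n) - (u : 'I_n))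
                          + ((u : 'I_n) - (w : 'I_n)))) u v.
  rewrite (_ : (u : 'I_n) - (v : 'I_n) = 0) ?addn0; last lia.
  apply; last by rewrite subnn /arc_dist min0n.
  move=> x y /andP[_]; have := ltn_ord (x : 'I_n); have := ltn_ord (y : 'I_n).
  have := ltn_ord (u : 'I_n); rewrite /arc_dist => lt_u lt_y lt_x.
  have modS (z : nat) : z < n ->
      z.+1 %% n = z.+1 /\ z.+1 < n \/ z.+1 %% n = 0 /\ z.+1 = n.
    rewrite leq_eqVlt => /predU1P[->|lt_z]; [right | left].
      by rewrite modnn.
    by rewrite modn_small.
  by case/orP=> /eqP ->; [case: (modS _ lt_x) | case: (modS _ lt_y)] => -[-> ?];
    lia.
- right; rewrite (_ : _ + _ = n + (u : 'I_n)); last lia.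
  by rewrite modnDl modn_small // ltn_ord.
- by left; rewrite modn_small; lia.
Qed.

(** * The increasing list of the elements of a set *)

Section Values.
Variable n : nat.
Implicit Type A : {set 'I_n}.

Definition values A : seq nat := [seq val x | x <- enum A].

Lemma mem_values A (x : 'I_n) : (val x \in values A) = (x \in A).
Proof. by rewrite mem_map ?mem_enum //; apply: val_inj. Qed.

Lemma size_values A : size (values A) = #|A|.
Proof. by rewrite size_map -cardE. Qed.

Lemma sorted_values A : sorted ltn (values A).
Proof.
rewrite sorted_map; apply: (@subseq_sorted _ _ _ _ (enum 'I_n)).
- by move=> ? ? ?; apply: ltn_trans.
- by rewrite enumT; apply: filter_subseq.
by rewrite -sorted_map val_enum_ord iota_ltn_sorted.
Qed.

Lemma nth_values_lt A i : i < #|A| -> nth 0 (values A) i < n.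
Proof.
move=> lt_i; have : nth 0 (values A) i \in values A.
  by rewrite mem_nth // size_values.
by case/mapP=> x _ ->; exact: ltn_ord.
Qed.

Lemma values_inc A i j : i < j < #|A| ->
  nth 0 (values A) i < nth 0 (values A) j < n.
Proof.
move=> /andP[lt_ij lt_j]; rewrite nth_values_lt // andbT.
apply: (sorted_ltn_nth ltn_trans 0 (sorted_values A));
  rewrite ?inE ?size_values //.
exact: ltn_trans lt_j.
Qed.

End Values.

Lemma energyE n (A : {set cycle_graph n}) (a := nth 0 (values A)) :
  energy A = (\sum_(j < #|A|) \sum_(i < j) recip_arc n (a j - a i))%R.
Proof.
rewrite /energy /dist_vector (perm_big _ (permEl (perm_sort _ _))) /=.
rewrite big_image /= (eq_bigl (fun p : 'I_n * 'I_n =>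
    (p.1 \in A) && ((p.2 \in A) && (p.1 < p.2)))); last first.
  by move=> p /=; rewrite inE !enum_rank_ord.
rewrite -(pair_big_dep (mem A) (fun u v => (v \in A) && (u < v))
  (fun u v => (dist (u : cycle_graph n) v)%:R^-1)%R) /=.
rewrite (exchange_big_dep (mem A)) /=; last by move=> u v _ /andP[].
transitivity (\sum_(y <- values A) \sum_(x <- values A | (x < y)%N)
                recip_arc n (y - x) : rat)%R.
  rewrite big_map big_enum /=; apply: eq_bigr => v A_v.
  rewrite big_map big_enum_cond /=.
  apply: eq_big => [u | u /andP[_ /andP[_ lt_uv]]]; first by rewrite A_v.
  rewrite dist_cycle // /recip_arc subn_gt0 lt_uv.
  by rewrite (leq_ltn_trans (leq_subr _ _) (ltn_ord v)).
have sz_a : size (values A) = #|A| := size_values A.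
rewrite (big_nth 0%N) big_mkord sz_a; apply: eq_bigr => j _.
rewrite (big_nth 0%N) big_mkord sz_a.
rewrite (big_ord_widen _ (fun i => recip_arc n (a j - a i)) (ltnW (ltn_ord j))).
apply: eq_bigl => i.
by rewrite -[RHS](lt_sorted_ltn_nth 0 (sorted_values A)) ?inE ?sz_a.
Qed.

(** * Evenly spaced sets are the maximally even ones *)

(** The condition with its denominators cleared: the numbers
    [m * a i - n * i] differ from each other by less than [m]. *)
Lemma evenly_spacedP n m (a : nat -> nat) :
    (forall i j, i < j < m -> a i < a j) ->
  reflect (forall i j, i < m -> j < m -> m * a i + n * j < m * a j + n * i + m)
          (evenly_spaced n m a).
Proof.
move=> inc_a; apply: (iffP 'forall_forallP) => [even_a i j lt_im lt_jm | even_a j i].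
  have ordered k l : k < l -> l < m ->
      (m * a k + n * l < m * a l + n * k + m) /\
      (m * a l + n * k < m * a k + n * l + m).
    move=> lt_kl lt_lm.
    have := even_a (Ordinal lt_lm) (Ordinal lt_kl); rewrite /=.
    have /ltnW := inc_a k l ltac:(lia); rewrite !mulnBr.
    have := leq_mul (leqnn n) (ltnW lt_kl).
    move=> h /(leq_mul (leqnn m)); lia.
  case: (ltngtP i j) => [lt_ij | lt_ji | ->]; last by lia.
  - by case: (ordered i j).
  - by case: (ordered j i).
have lt_ij := ltn_ord i; have lt_jm := ltn_ord j.
have := even_a i j; have := even_a j i; rewrite !mulnBr.
have /ltnW := inc_a i j ltac:(lia).
have := leq_mul (leqnn n) (ltnW lt_ij).
move=> h /(leq_mul (leqnn m)); lia.
Qed.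

Definition J_elt n m r i : nat := (n * i + r) %/ m.

Lemma J_elt_lt n m r i : r < n -> i < m -> J_elt n m r i < n.
Proof.
move=> lt_rn lt_im; rewrite /J_elt ltn_divLR; last lia.
have : n * i.+1 <= n * m by rewrite leq_mul2l lt_im orbT.
rewrite mulnS; lia.
Qed.

Lemma J_elt_inc n m r i j : 0 < m <= n -> i < j -> J_elt n m r i < J_elt n m r j.
Proof.
move=> /andP[m_gt0 le_mn] lt_ij; rewrite /J_elt leq_divRL // mulSn.
have := leq_divM (n * i + r) m.
have : n * i.+1 <= n * j by rewrite leq_mul2l lt_ij orbT.
rewrite mulnS; lia.
Qed.

Lemma J_elt_even n m r i j : 0 < m ->
  m * J_elt n m r i + n * j < m * J_elt n m r j + n * i + m.
Proof.
move=> m_gt0; rewrite /J_elt.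
have := divn_eq (n * i + r) m; have := divn_eq (n * j + r) m.
have := ltn_pmod (n * j + r) m_gt0.
rewrite ![m * (_ %/ _)]mulnC; lia.
Qed.

(** The parameter [r] is the maximum of [m * a i - n * i].  Truncating these
    differences at 0 is harmless, as the one for [i = 0] is not negative. *)
Lemma evenly_spaced_J_elt n m (a : nat -> nat) : 0 < m ->
    (forall i, i < m -> a i < n) ->
    (forall i j, i < m -> j < m -> m * a i + n * j < m * a j + n * i + m) ->
  exists2 r, r < n & forall i, i < m -> a i = J_elt n m r i.
Proof.
move=> m_gt0 lt_an even_a; pose r := \max_(i < m) (m * a i - n * i).
have r_ge i : i < m -> m * a i <= n * i + r.
  by move=> lt_im; rewrite -leq_subLR (leq_bigmax (Ordinal lt_im)).
have r_lt i : i < m -> n * i + r < m * a i + m.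
  move=> lt_im.
  have [i0 def_r] : {i0 : 'I_m | r = m * a i0 - n * i0}.
    by apply: (bigop.eq_bigmax (fun i : 'I_m => m * a i - n * i));
      rewrite card_ord.
  have := even_a i0 i (ltn_ord i0) lt_im; have := even_a 0 i m_gt0 lt_im.
  rewrite def_r; lia.
exists r.
  (* The last element is at most [n - 1], so [m * a i - n * i] is at most
     [n - m] for [i = m - 1], hence less than [n] for all [i]. *)
  have := r_lt m.-1 ltac:(lia).
  have : m * a m.-1 + m <= m * n.
    by rewrite -mulnSr leq_mul2l lt_an ?prednK ?orbT.
  have : n * m = n * m.-1 + n by rewrite -mulnSr prednK.
  rewrite (mulnC m n); lia.
move=> i lt_im; apply/eqP.
rewrite eqn_leq /J_elt leq_divRL // [a i * m]mulnC r_ge //=.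
have up := r_lt i lt_im.
have : (n * i + r) %/ m < (a i).+1 by rewrite ltn_divLR // mulSn; lia.
by [].
Qed.

Lemma values_J n m r : m <= n -> r < n ->
  values (J n m r) = mkseq (J_elt n m r) m.
Proof.
move=> le_mn lt_rn; apply: (irr_sorted_eq ltn_trans ltnn (sorted_values _)).
  apply/(sortedP 0) => i; rewrite size_mkseq => lt_im.
  rewrite !nth_mkseq //; last exact: ltnW.
  by apply: J_elt_inc => //; lia.
move=> x; apply/mapP/mapP=> [[y] | [i]].
  rewrite mem_enum inE => /existsP[i /eqP def_y] ->.
  by exists (val i); rewrite ?mem_iota //=; have := ltn_ord i; lia.
rewrite mem_iota add0n => /= lt_im ->.
exists (Ordinal (J_elt_lt lt_rn lt_im)) => //.
by rewrite mem_enum inE; apply/existsP; exists (Ordinal lt_im).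
Qed.

Lemma card_J n m r : m <= n -> r < n -> #|J n m r| = m.
Proof. by move=> le_mn lt_rn; rewrite -size_values values_J // size_mkseq. Qed.

Lemma maximally_evenP n (A : {set 'I_n}) : 0 < #|A| ->
  maximally_even A <-> evenly_spaced n #|A| (nth 0 (values A)).
Proof.
move=> A_gt0; have le_An : #|A| <= n by rewrite -[n in _ <= n]card_ord max_card.
have inc_a i j : i < j < #|A| -> nth 0 (values A) i < nth 0 (values A) j.
  by case/values_inc/andP.
split=> [[_ [r lt_rn def_A]] | /(evenly_spacedP _ inc_a) even_A].
  apply/(evenly_spacedP _ inc_a) => i j lt_i lt_j.
  by rewrite {2 4}def_A values_J // !nth_mkseq // J_elt_even.
have [r lt_rn def_a] := evenly_spaced_J_elt A_gt0 (@nth_values_lt _ A) even_A.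
split=> //; exists r => //; apply/setP=> x; rewrite -!mem_values values_J //.
congr (_ \in _); apply: (@eq_from_nth _ 0);
  rewrite size_values ?size_mkseq // => i lt_i.
by rewrite nth_mkseq // def_a.
Qed.

(** * Minimal energy *)

Lemma energy_leif n (A : {set cycle_graph n}) : 0 < n ->
  (sum_bound n #|A| (recip_arc n) <= energy A *+ 2
    ?= iff evenly_spaced n #|A| (nth 0%N (values A)))%R.
Proof.
move=> n_gt0; rewrite energyE; apply: sum_gaps_leif => //.
- exact: recip_arc_convex.
- exact: recip_arc_sym.
- exact: (@values_inc n A).
Qed.

Theorem theorem1 (n : nat) (n_gt0 : 0 < n) (A : {set cycle_graph n})
    (A_neq0 : A != set0) :
  minimal_energy A <-> maximally_even A.
Proof.
have A_gt0 : 0 < #|A| by rewrite card_gt0.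
have le_An : #|A| <= n by rewrite -[n in _ <= n]card_ord max_card.
have [ge_bound eq_bound] := energy_leif A n_gt0.
split=> [min_A | /(maximally_evenP A_gt0) even_A].
  apply/(maximally_evenP A_gt0).
  pose B : {set cycle_graph n} := J n #|A| 0.
  have card_B : #|B| = #|A| by exact: card_J.
  have B_gt0 : 0 < #|B| by rewrite card_B.
  have even_B : evenly_spaced n #|B| (nth 0 (values B)).
    by apply/(maximally_evenP B_gt0); split=> //; exists 0; rewrite ?card_B.
  have [_ eq_B] := energy_leif B n_gt0; rewrite even_B card_B in eq_B.
  rewrite -eq_bound eq_le ge_bound (eqP eq_B) lerMn2r /=.
  exact: min_A.
move=> B card_B; have [ge_B _] := energy_leif B n_gt0.
rewrite -(@ler_pMn2r _ 2) //; rewrite even_A card_B in eq_bound ge_B.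
by rewrite -(eqP eq_bound).
Qed.
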